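(* There exists an infinite regular feebly compact $\mathbb{R}$-rigid quasitopological group $H$. Therefore, $H$ is neither completely regular nor functionally Hausdorff.
   Context: A quasitopological group is a group with a topology such that all left and right translations and the inversion are continuous. A space is regular if it is $T_1$ and every open neighborhood $U$ of a point $x$ contains an open neighborhood $V$ of $x$ with $\overline{V}\subseteq U$. A space is feebly compact if every locally finite family of open subsets of it is finite. A space is $\mathbb{R}$-rigid if every continuous real-valued function on it is constant. A space is functionally Hausdorff if continuous real-valued functions on it separate its points. Completely regular means $T_1$ plus: for every closed set $F$ and point $x\notin F$ there is a continuous $f\colon X\to\mathbb{R}$ with $f(x)=1$ and $f(F)\subseteq\{0\}$. *)

(* Defs.v *)
From HB Require Import structures.
From mathcomp Require Import all_boot all_order all_algebra.
From mathcomp Require Import all_classical all_reals.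
From mathcomp Require Import topology.
From mathcomp Require Import Rstruct Rstruct_topology.
From Stdlib Require Import Reals.

Set Implicit Arguments.
Unset Strict Implicit.
Unset Printing Implicit Defensive.

Local Open Scope classical_set_scope.

Definition is_group (G : Type) (mul : G -> G -> G) (e : G) (inv : G -> G) : Prop :=
  (forall x y z, mul x (mul y z) = mul (mul x y) z) /\
  (forall x, mul e x = x /\ mul x e = x) /\
  (forall x, mul (inv x) x = e /\ mul x (inv x) = e).

Definition quasitopological_group (T : topologicalType)
  (mul : T -> T -> T) (e : T) (inv : T -> T) : Prop :=
  is_group mul e inv /\
  (forall a : T, continuous (fun x => mul a x)) /\
  (forall a : T, continuous (fun x => mul x a)) /\
  continuous inv.

Definition T1_space (T : topologicalType) : Prop :=
  forall x y : T, x <> y -> exists U : set T, open U /\ U x /\ ~ U y.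

Definition regular_sp (T : topologicalType) : Prop :=
  T1_space T /\
  forall (x : T) (U : set T), open U -> U x ->
    exists V : set T, open V /\ V x /\ closure V `<=` U.

Definition locally_finite_family (T : topologicalType) (F : set (set T)) : Prop :=
  forall x : T, exists U : set T, open U /\ U x /\
    finite_set [set A | F A /\ A `&` U !=set0].

Definition feebly_compact (T : topologicalType) : Prop :=
  forall F : set (set T), (forall A, F A -> open A) ->
    locally_finite_family F -> finite_set F.

Definition R_rigid (T : topologicalType) : Prop :=
  forall f : T -> R, continuous f -> forall x y : T, f x = f y.

Definition functionally_Hausdorff (T : topologicalType) : Prop :=
  forall x y : T, x <> y -> exists f : T -> R, continuous f /\ f x <> f y.

Definition completely_regular (T : topologicalType) : Prop :=
  T1_space T /\
  forall (F : set T) (x : T), closed F -> ~ F x ->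
    exists f : T -> R, continuous f /\ f x = 1%R /\ (forall y, F y -> f y = 0%R).

(* Main.v *)
(** The space H is a Korovin orbit.  Let Z be a regular R-rigid space in which
    every sequence converges along every ultrafilter on nat.  Let H be a Boolean
    group with a map f : H -> Z such that every map from a countable subset of H
    to Z is g |-> f (h + g) for some h.  Embed H into Z^H by sending h to
    g |-> f (h + g): translations are continuous, inversion is the identity, and
    countable families of coordinates can be prescribed arbitrarily.  Hence H is
    feebly compact, continuous real functions on H depend on countably many
    coordinates, and changing the coordinates one at a time shows that they are
    constant.  Such an f exists on the finite sets of well-founded codes, each of
    which encodes a sequence in H together with a sequence of values in Z.

    To get Z, start with a chain, indexed by the integers, of planks X0 * 2^S,
    where X0 is the set of co-countable elements of 2^S with S uncountable; the
    diagonal of a plank is glued to the zero section of the next one, and an end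
    point is added on each side.  A continuous real function on a plank depends
    on countably many coordinates, so it agrees at (x, 0) and (x, x) for some x;
    hence no continuous real function separates the end points a and b.  The
    points of Z are the compact sets of countable support that contain a, where
    all those that contain b are collapsed to one point.  Moving x from a to b
    in F `|` [set x] joins every F to that point, so Z is R-rigid. *)

Require Import Defs.
From mathcomp Require Import all_boot all_order all_algebra.
From mathcomp Require Import all_classical all_reals.
From mathcomp Require Import topology.
From mathcomp Require Import interval_inference normedtype.
From mathcomp Require Import Rstruct Rstruct_topology.
From HB Require Import structures.
From mathcomp Require Import zify lra.

Set Implicit Arguments.
Unset Strict Implicit.
Unset Printing Implicit Defensive.

Import Order.TTheory GRing.Theory Num.Theory numFieldNormedType.Exports.
Local Open Scope classical_set_scope.
Local Open Scope ring_scope.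

(** * Countable sets, filters and limits along ultrafilters *)

Lemma countableU (T : Type) (A B : set T) :
  countable A -> countable B -> countable (A `|` B).
Proof.
move=> cA cB; rewrite -bigcup2inE; apply: bigcup_countable => // -[|[|n]] //.
Qed.

Lemma filter_seq_forall (T : Type) (J : eqType) (F : set_system T)
    (FF : Filter F) (l : seq J) (B : J -> set T) :
  (forall j, j \in l -> F (B j)) -> F [set x | forall j, j \in l -> B j x].
Proof.
elim: l => [_|j l IHl Fl]; first by apply: filterS filterT.
have Fj : F (B j) by apply: Fl; rewrite mem_head.
have {}IHl := IHl (fun i il => Fl i (mem_behead (s := j :: l) il)).
apply: filterS (filterI Fj IHl) => x [Bj Bl] i.
by rewrite inE => /orP[/eqP->//|/Bl].
Qed.

Section ultralimits.
Variable p : set_system nat.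

Definition ultralimit (P : topologicalType) (u : nat -> P) (x : P) :=
  forall U, open U -> U x -> p (u @^-1` U).

(** For an ultrafilter [p] this is [p]-compactness, which is weaker than compactness. *)
Definition ultracompact (P : topologicalType) :=
  forall u : nat -> P, exists x, ultralimit u x.

Lemma compact_ultralimit (P : topologicalType) (K : set P) (u : nat -> P) :
  UltraFilter p -> compact K -> (forall n, K (u n)) ->
  exists x, K x /\ ultralimit u x.
Proof.
move=> up cK Ku.
have pp := ultra_proper (F := p).
have [x [Kx clx]] : K `&` cluster (u @ p) !=set0.
  have uK : p (u @^-1` K) by apply: filterS filterT => n _; exact: Ku.
  exact: cK.
exists x; split=> // U oU Ux.
have [//|nU] := in_ultra_setVsetC (u @^-1` U) up.
have [] := clx (~` U) U nU; first exact: open_nbhs_nbhs.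
by move=> y [].
Qed.

End ultralimits.

Lemma free_ultrafilter : exists p : set_system nat,
  UltraFilter p /\ forall N, p [set n | (N <= n)%N].
Proof.
have [p [up sp]] := ultraFilterLemma (eventually_filter).
by exists p; split=> // N; apply: sp; exists N.
Qed.

(** * Sets that project onto all countable subproducts of a power *)

Section coordinates.
Variables (T : Type) (I : eqType) (P : topologicalType) (e : T -> I -> P).

Definition countably_full :=
  forall A : set I, countable A ->
  forall u : I -> P, exists t, forall i, A i -> e t i = u i.

(** Neighborhoods for the topology induced by the product [P^I] through [e]. As [T] is a bare type,
    the notion serves both the orbit and the planks of the chain. *)
Definition coord_nbhs (t : T) (U : set T) :=
  exists l : seq (I * set P),
    (forall q, q \in l -> open q.2 /\ q.2 (e t q.1)) /\
    (forall t', (forall q, q \in l -> q.2 (e t' q.1)) -> U t').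

Definition coord_continuous (K : realType) (phi : T -> K) :=
  forall t eps, 0 < eps -> coord_nbhs t [set t' | `|phi t' - phi t| < eps].

Lemma countable_mem (l : seq I) : countable [set i | i \in l].
Proof. exact: finite_set_countable (finite_seq l). Qed.

Hypothesis full : countably_full.

Variables (p : set_system nat) (up : UltraFilter p).
Hypothesis free : forall N, p [set n | (N <= n)%N].
Hypothesis ucP : ultracompact p P.

Let pp : ProperFilter p := ultra_proper.

(* Along the sequence [s] of points and the increasing lists [L] of coordinates
   there is a point [t] such that any neighborhood of [t] meets, for [p]-many
   [n], each set of points that are prescribed on [L n.+1], provided that they
   agree with [s n] on [L n]. *)
Lemma ultralimit_diagonal (s : nat -> T) (L : nat -> seq I) :
  (forall m n, (m <= n)%N -> {subset L m <= L n}) ->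
  exists t, forall U, coord_nbhs t U ->
    p [set n | forall t0, (forall i, i \in L n -> e t0 i = e (s n) i) ->
        exists t', U t' /\ forall i, i \in L n.+1 -> e t' i = e t0 i].
Proof.
move=> Lmon.
have [v vP] := choice (fun i => ucP (fun n => e (s n) i)).
pose A := [set i | exists n, i \in L n].
have cA : countable A.
  have -> : A = \bigcup_(n in setT) [set i | i \in L n].
    by rewrite predeqE => i; split=> [[n il]|[n _ il]]; exists n.
  by apply: bigcup_countable => // n _; exact: countable_mem.
have [t tv] := full cA v.
exists t => U [l [lt lU]].
have pB : p [set n | forall q, q \in l ->
    A q.1 -> q.1 \in L n /\ q.2 (e (s n) q.1)].
  apply: filter_seq_forall => q ql.
  have [Aq|nAq] := pselect (A q.1); last by apply: filterS filterT.
  have [oq qt] := lt _ ql; rewrite tv // in qt.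
  have [N LN] := Aq.
  apply: filterS (filterI (free N) (vP q.1 _ oq qt)) => n [/= Nn qn] _.
  by split=> //; exact: Lmon LN.
apply: filterS pB => n Bn t0 t0s.
pose M := L n.+1 ++ [seq q.1 | q <- l].
(* A coordinate of [l] in [L n.+1] lies in [A], so [Bn] puts it in [L n], where [t0] agrees with
   [s n]; the other coordinates of [l] are copied from [t]. *)
have [t' t'P] := full (countable_mem M)
  (fun i => if i \in L n.+1 then e t0 i else e t i).
exists t'; split; last first.
  by move=> i iL; rewrite t'P ?iL //= mem_cat iL.
apply: lU => q ql.
have qM : q.1 \in M by rewrite mem_cat map_f ?orbT.
rewrite t'P //; case: ifP => qL; last by have [] := lt _ ql.
have [qLn qs] := Bn q ql (ex_intro _ n.+1 qL).
by rewrite t0s.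
Qed.

Section real_functions.
Variables (K : realType) (phi : T -> K).
Hypothesis phic : coord_continuous phi.

(** Otherwise each list [l] has a pair [F l] that agrees on [l] with values more than [eps] apart.
    The lists [L n] absorb the coordinates that control [phi] near these pairs, so near the diagonal
    point [t] two points imitate both members of one pair, although their values are close. *)
Lemma coord_continuous_osc eps : 0 < eps -> exists l : seq I,
  forall t t', (forall i, i \in l -> e t i = e t' i) ->
  `|phi t - phi t'| <= eps.
Proof.
move=> eps0; apply: contrapT => noL.
have bad (l : seq I) : exists tt : T * T,
    (forall i, i \in l -> e tt.1 i = e tt.2 i) /\
    eps < `|phi tt.1 - phi tt.2|.
  apply: contrapT => nb; apply: noL; exists l => t t' tt'.
  by rewrite leNgt; apply/negP => lt_eps; apply: nb; exists (t, t').
have {bad}[F FP] := choice bad.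
(* The final estimate adds two errors below [eps / 3] at the pair and two below [eps / 6] at [t]. *)
have eps3 : 0 < eps / 3 by lra.
have eps6 : 0 < eps / 6 by lra.
have [N NP] := choice (fun t => phic t eps3).
pose supp t := [seq q.1 | q <- N t].
pose L n := iter n (fun l => l ++ supp (F l).1 ++ supp (F l).2) [::].
have Lmon m n : (m <= n)%N -> {subset L m <= L n}.
  move=> /subnK <-; elim: (n - m)%N => // d IHd i iL.
  by rewrite addSn /= mem_cat IHd.
have [t tP] := ultralimit_diagonal (fun n => (F (L n)).1) Lmon.
have [n nP] := filter_ex (tP _ (phic t eps6)).
have [F12 epsF] := FP (L n).
have [t1 [/= t1t t1F]] := nP (F (L n)).1 (fun _ _ => erefl).
have [t2 [/= t2t t2F]] := nP (F (L n)).2 (fun i iL => esym (F12 i iL)).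
have closeF s s' : {subset supp s <= L n.+1} ->
    (forall i, i \in L n.+1 -> e s' i = e s i) -> `|phi s' - phi s| < eps / 3.
  move=> sL s'e; have [Ns sN] := NP s; apply: sN => q qN.
  by have [_ qs] := Ns q qN; rewrite s'e // sL // map_f.
have c1 : `|phi t1 - phi (F (L n)).1| < eps / 3.
  by apply: closeF => // i; rewrite /= !mem_cat => ->; rewrite orbT.
have c2 : `|phi t2 - phi (F (L n)).2| < eps / 3.
  by apply: closeF => // i; rewrite /= !mem_cat => ->; rewrite !orbT.
move: epsF t1t t2t c1 c2; rewrite !lter_norml ltr_normr => /orP[] ?;
  move=> /andP[? ?] /andP[? ?] /andP[? ?] /andP[? ?]; lra.
Qed.

Lemma coord_continuous_countable : exists A : set I, countable A /\
  forall t t', (forall i, A i -> e t i = e t' i) -> phi t = phi t'.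
Proof.
have pos n : 0 < n.+1%:R^-1 :> K by rewrite invr_gt0 ltr0n.
have [l lP] := choice (fun n => coord_continuous_osc (pos n)).
exists (\bigcup_(n in setT) [set i | i \in l n]); split.
  by apply: bigcup_countable => // n _; exact: countable_mem.
move=> t t' tt'; apply/eqP; rewrite -subr_eq0 -normr_le0 leNgt.
apply/negP => d0.
have [n _] := near_infty_natSinv_lt (PosNum d0).
move=> /(_ n (leqnn n)) /=; rewrite ltNge lP // => i il.
by apply: tt'; exists n.
Qed.

(** Varying one coordinate gives a continuous function on [P], which is constant. Induction covers
    finitely many coordinates, and continuity the rest. *)
Lemma coord_continuous_rigid :
  (forall (f : P -> K), continuous f -> forall x y, f x = f y) ->
  forall t t', phi t = phi t'.
Proof.
move=> rigP.
have [A [cA phiA]] := coord_continuous_countable.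
have one_coord i t t' :
    (forall j, A j -> j != i -> e t j = e t' j) -> phi t = phi t'.
  move=> tt'.
  have [sg sgP] := choice (fun v : P =>
    full cA (fun j => if j == i then v else e t j)).
  (* Only the coordinates in [A] of [sg] are controlled, so [sg] itself may be discontinuous. The
     point [t1] below copies [sg w] on [A] and [sg v] at the other coordinates of [l]. *)
  have csg : continuous (phi \o sg).
    move=> v; apply/cvgrPdist_lt => eps eps0.
    have [l [lv lphi]] := phic (sg v) eps0.
    have nv : nbhs v [set w | forall q, q \in l -> q.1 = i -> A i -> q.2 w].
      apply: filter_seq_forall => q ql.
      have [oq qv] := lv _ ql.
      have [[qi Ai]|nqi] := pselect (q.1 = i /\ A i).
        apply: filterS (open_nbhs_nbhs (conj oq _)) => //.
        by move: qv; rewrite sgP qi ?eqxx.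
      by apply: filterS filterT => w _ qi Ai; case: nqi.
    near=> w.
    have nw : forall q, q \in l -> q.1 = i -> A i -> q.2 w by near: w.
    have cB : countable (A `|` [set j | j \in [seq q.1 | q <- l]]).
      by apply: countableU => //; exact: countable_mem.
    have [t1 t1P] := full cB
      (fun j => if pselect (A j) then e (sg w) j else e (sg v) j).
    have t1A : phi (sg w) = phi t1.
      by apply: phiA => j Aj; rewrite t1P; [case: pselect|left].
    rewrite distrC /= t1A; apply: lphi => q ql.
    have [_ qv] := lv _ ql.
    rewrite t1P; last by right; apply: map_f.
    case: pselect => // Aq; rewrite sgP //; rewrite sgP // in qv.
    by case: eqP qv => // qi _; apply: nw; rewrite -?qi.
  have := rigP _ csg (e t i) (e t' i); rewrite /=.
  rewrite (phiA _ t) => [->|j Aj]; last by rewrite sgP //; case: eqP => // ->.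
  apply: phiA => j Aj; rewrite sgP //; case: eqP => [->//|/eqP ji].
  exact: tt'.
have fin_coord (l : seq I) : forall t t',
    (forall j, A j -> j \notin l -> e t j = e t' j) -> phi t = phi t'.
  elim: l => [|i l IHl] t t' tt'; first by apply: phiA => j Aj; apply: tt'.
  have [t1 t1P] := full cA (fun j => if j == i then e t' j else e t j).
  rewrite (one_coord i t t1); last first.
    by move=> j Aj ji; rewrite t1P // (negbTE ji).
  apply: IHl => j Aj jl; rewrite t1P //; case: eqP => // /eqP ji.
  by apply: tt' => //; rewrite inE (negbTE ji).
move=> t t'; apply/eqP; rewrite -subr_eq0 -normr_le0 leNgt; apply/negP => d0.
have [l [lt lphi]] := phic t' d0.
have cB : countable (A `|` [set j | j \in [seq q.1 | q <- l]]).
  by apply: countableU => //; exact: countable_mem.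
(* [z] is close to [t'], yet on [A] it differs from [t] at finitely many coordinates only. *)
have [z zP] := full cB
  (fun j => if j \in [seq q.1 | q <- l] then e t' j else e t j).
have zt : phi z = phi t.
  apply: (fin_coord [seq q.1 | q <- l]) => j Aj jl.
  by rewrite zP; [rewrite (negbTE jl)|left].
suff : `|phi t - phi t'| < `|phi t - phi t'| by rewrite ltxx.
rewrite -{1}zt; apply: lphi => q ql.
have ql1 : q.1 \in [seq q.1 | q <- l] by apply: map_f.
by rewrite zP; [rewrite ql1; have [] := lt _ ql|right].
Unshelve. all: by end_near.
Qed.

End real_functions.
End coordinates.

(** Given infinitely many nonempty members [g n] with points [s n], let [L n] collect coordinates
    that ensure membership in the earlier ones. Each neighborhood of the diagonal point then meets
    [g n] for [p]-many [n], against local finiteness. *)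
Lemma coord_feebly_compact (T : topologicalType) (I : eqType)
    (P : topologicalType) (e : T -> I -> P) (p : set_system nat) :
  UltraFilter p -> (forall N, p [set n | (N <= n)%N]) -> ultracompact p P ->
  countably_full e ->
  (forall t U, open U -> U t -> coord_nbhs e t U) -> feebly_compact T.
Proof.
move=> up free ucP full base F Fo Flf.
have pp : ProperFilter p := ultra_proper.
apply: contrapT => infF.
have infF0 : infinite_set (F `\ set0).
  apply: infinite_setD => //; exact: finite_set1.
have /ppcard_leP[g] := (infiniteP _).1 infF0.
have gF (n : nat) : (F `\ set0) (g n) by apply: funS.
have gn (n : nat) : exists s, g n s.
  by have [_ gn0] := gF n; apply/set0P/eqP.
have [s sg] := choice gn.
have [N NP] := choice (fun n => base (s n) (g n) (Fo _ (gF n).1) (sg n)).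
pose L n := flatten [seq [seq q.1 | q <- N k] | k <- iota 0 n].
have Lmon m n : (m <= n)%N -> {subset L m <= L n}.
  move=> mn i /flatten_mapP[k]; rewrite mem_iota => /andP[_ km] ik.
  apply/flatten_mapP; exists k => //; rewrite mem_iota /=; lia.
have [t tP] := ultralimit_diagonal full up free ucP s Lmon.
have [U [oU [Ut finU]]] := Flf t.
have pU := tP U (base _ _ oU Ut).
have finB : finite_set [set n | (g n `&` U) !=set0].
  apply: (@sub_finite_set _ _ (g @^-1` [set A | F A /\ A `&` U !=set0])).
    by move=> n /= gU; split=> //; exact: (gF n).1.
  by apply: finite_preimage => // x y _ _; apply: inj; rewrite inE.
have [M MP] : exists M, forall n, (g n `&` U) !=set0 -> (n < M)%N.
  have [l lP] := (finite_seqP _).1 finB.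
  exists (\max_(n <- l) n).+1 => n gn0; rewrite ltnS.
  have nl : n \in l by have : [set` l] n by rewrite -lP.
  by rewrite (big_rem n) //= leq_max leqnn.
have [n [/= Mn nP]] := filter_ex (filterI (free M) pU).
have [t' [Ut' t'L]] := nP (s n) (fun _ _ => erefl).
have : (n < M)%N.
  apply: MP; exists t'; split=> //; have [Nn Ng] := NP n; apply: Ng => q qN.
  rewrite t'L; first by have [] := Nn _ qN.
  apply/flatten_mapP; exists n; last exact: map_f.
  by rewrite mem_iota /= add0n ltnSn.
by rewrite ltnNge Mn.
Qed.

(** * Compact sets in regular spaces *)

Section topology_lemmas.
Variable T : topologicalType.

Lemma open_local (A : set T) :
  (forall x, A x -> exists U, [/\ open U, U x & U `<=` A]) -> open A.
Proof.
move=> Aloc; rewrite openE => x /Aloc[U [oU Ux UA]].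
by rewrite /interior nbhsE; exists U.
Qed.

Lemma closure_sub_disjoint (V B : set T) :
  (forall y, ~ B y -> exists W, [/\ open W, W y & V `&` W = set0]) ->
  closure V `<=` B.
Proof.
move=> sep y clVy; apply: contrapT => /sep[W [oW Wy VW]].
by have [z] := clVy W (open_nbhs_nbhs (conj oW Wy)); rewrite VW.
Qed.

(** The parts of [F] outside open sets [V] with closure in [U] generate a filter. If no [V] covers
    [F], it is proper and clusters at a point of [F], which regularity refutes. *)
Lemma compact_regular_nbhd (F U : set T) : regular_sp T -> compact F ->
  open U -> F `<=` U -> exists V, [/\ open V, F `<=` V & closure V `<=` U].
Proof.
move=> [_ reg] cF oU FU.
apply: contrapT => noV.
pose G := [set A | exists V, [/\ open V, closure V `<=` U & F `\` V `<=` A]].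
have GF : ProperFilter G.
  apply: Build_ProperFilter_ex => [A [V [oV clV sA]]|].
    apply: contrapT => A0; apply: noV; exists V; split=> // x Fx.
    by apply: contrapT => nVx; apply: A0; exists x; apply: sA.
  split.
  - by exists set0; split=> //; [exact: open0|rewrite closure0].
  - move=> A B [V [oV clV sA]] [W [oW clW sB]]; exists (V `|` W).
    split; first exact: openU.
    + by rewrite closureU subUset.
    + by move=> x [Fx /not_orP[nVx nWx]]; split; [apply: sA|apply: sB].
  - by move=> A B AB [V [oV clV sA]]; exists V; split=> // x /sA/AB.
have [x [Fx clx]] : F `&` cluster G !=set0.
  apply: cF; exists set0; split; [exact: open0|by rewrite closure0|].
  by move=> x [].
have [V [oV [Vx clV]]] := reg x U oU (FU x Fx).
have GV : G (F `\` V) by exists V; split.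
by have [z [[_ nVz] Vz]] := clx _ _ GV (open_nbhs_nbhs (conj oV Vx)).
Qed.

Lemma regular_closed_compact (K : set T) : regular_sp T -> compact K ->
  closed K.
Proof.
move=> [T1 reg] cK; apply: (compact_closed _ cK) => x y clxy.
apply: contrapT => xy; have [U [oU [Ux nUy]]] := T1 _ _ xy.
have [V [oV [Vx clV]]] := reg _ _ oU Ux.
apply: nUy; apply: clV => W nW.
have [z [Wz Vz]] := clxy V W (open_nbhs_nbhs (conj oV Vx)) nW.
by exists z.
Qed.

Lemma T1_closed1 (x : T) : T1_space T -> closed [set x].
Proof.
move=> T1; rewrite -openC; apply: open_local => y /= yx.
have [U [oU [Uy nUx]]] := T1 y x yx.
by exists U; split=> // z Uz zx; apply: nUx; rewrite -zx.
Qed.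

End topology_lemmas.

(** * Topologies generated by a subbase *)

Definition subbase_space (T : Type) (I : eqType) (D : set I)
  (b : I -> set T) : Type := T.

Section subbase.
Variables (T : Type) (I : eqType) (D : set I) (b : I -> set T).
Local Notation S := (subbase_space D b).

Definition subbase_open (U : set S) := forall x, U x -> exists l : seq I,
  (forall i, i \in l -> D i /\ b i x) /\
  (forall y, (forall i, i \in l -> b i y) -> U y).

Let subbase_openT : subbase_open [set: S].
Proof. by move=> x _; exists [::]. Qed.

Let subbase_openI : setI_closed subbase_open.
Proof.
move=> U V oU oV x [/oU[l [lx lU]] /oV[m [mx mV]]].
exists (l ++ m); split=> [i|y lmy].
  by rewrite mem_cat => /orP[/lx|/mx].
by split; [apply: lU|apply: mV] => i il; apply: lmy; rewrite mem_cat il ?orbT.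
Qed.

Let subbase_open_bigU (J : Type) (f : J -> set S) :
  (forall j, subbase_open (f j)) -> subbase_open (\bigcup_j f j).
Proof.
move=> fo x [j _ /fo[l [lx lf]]]; exists l; split=> // y /lf fy.
by exists j.
Qed.

HB.instance Definition _ := gen_eqMixin S.
HB.instance Definition _ := gen_choiceMixin S.
HB.instance Definition _ := isOpenTopological.Build S
  subbase_openT subbase_openI subbase_open_bigU.

Lemma subbase_openP (U : set S) : open U <-> subbase_open U.
Proof. by []. Qed.

Lemma open_subbase i : D i -> open (b i : set S).
Proof.
move=> Di; apply/subbase_openP => x bx; exists [:: i]; split=> [j|y].
  by rewrite inE => /eqP->.
by apply; rewrite mem_head.
Qed.

Lemma subbase_nbhsP (x : S) (U : set S) : open U -> U x -> exists l : seq I,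
  (forall i, i \in l -> D i /\ b i x) /\
  (forall y, (forall i, i \in l -> b i y) -> U y).
Proof. by move=> oU; apply: (subbase_openP U).1. Qed.

Lemma continuous_subbase (X : topologicalType) (f : X -> S) :
  (forall i, D i -> open (f @^-1` b i)) -> continuous f.
Proof.
move=> fo; apply/continuousP => U oU; apply: open_local => x Ux.
have [l [lx lU]] := subbase_nbhsP oU Ux.
have : nbhs x [set y | forall i, i \in l -> b i (f y)].
  apply: filter_seq_forall => i il; have [Di bi] := lx i il.
  by apply: open_nbhs_nbhs; split=> //; exact: fo.
rewrite nbhsE => -[V [oV Vx] sV]; exists V; split=> // y /sV; exact: lU.
Qed.

Lemma subbase_ultralimit (p : set_system nat) (u : nat -> S) (x : S) :
  Filter p -> (forall i, D i -> b i x -> p (u @^-1` b i)) -> ultralimit p u x.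
Proof.
move=> pF ux U oU Ux; have [l [lx lU]] := subbase_nbhsP oU Ux.
have : p [set n | forall i, i \in l -> b i (u n)].
  by apply: filter_seq_forall => i /lx[]; exact: ux.
by apply: filterS => n; exact: lU.
Qed.

Lemma subbase_regular : T1_space S ->
  (forall i x, D i -> b i x ->
    exists V : set S, [/\ open V, V x & closure V `<=` b i]) ->
  regular_sp S.
Proof.
move=> T1 shrink; split=> // x U oU Ux.
have [l [lx lU]] := subbase_nbhsP oU Ux.
suff [V [oV Vx Vl]] : exists V : set S, [/\ open V, V x &
    forall y, closure V y -> forall i, i \in l -> b i y].
  by exists V; split=> //; split=> // y /Vl; exact: lU.
elim: l lx {lU} => [_|i l IHl lx]; first by exists setT; split=> //; exact: openT.
have [|V [oV Vx Vl]] := IHl.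
  by move=> j jl; apply: lx; rewrite inE jl orbT.
have [Di bi] := lx i (mem_head _ _).
have [W [oW Wx Wi]] := shrink i x Di bi.
exists (V `&` W); split=> //; first exact: openI.
move=> y clVW j; rewrite inE => /orP[/eqP->|].
  by apply: Wi; apply: closureS clVW; exact: subIsetr.
by apply: Vl; apply: closureS clVW; exact: subIsetl.
Qed.

End subbase.

(** * The hyperspace of compact sets with a collapsed point *)

Section hyperspace.
Variables (X : topologicalType) (a b : X) (Kf : set (set X)).
Hypotheses (regX : regular_sp X) (ab : a <> b).
Hypothesis compactK : forall K, Kf K -> compact K.
Hypothesis directedK : forall F : nat -> set X, (forall n, Kf (F n)) ->
  exists K, Kf K /\ forall n, F n `<=` K.
Hypothesis coverK : forall x, exists K, Kf K /\ K x.

(* The compact sets that contain [b] are all collapsed to the point [[set b]]. *)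
Definition hyperpoint (F : set X) :=
  [/\ closed F, exists K, Kf K /\ F `<=` K & (F a /\ ~ F b) \/ F = [set b]].

Definition hyper := {F : set X | hyperpoint F}.

(** The Vietoris topology, except that containment in [U] is an open condition only if [U] misses
    [b]. Thus neighborhoods of the collapsed point only ask to meet neighborhoods of [b]. *)
Definition hyper_subbase_dom : set (bool * set X) :=
  [set i : bool * set X | open i.2 /\ (i.1 -> ~ i.2 b)].

Definition hyper_subbase (i : bool * set X) : set hyper :=
  if i.1 then [set F | sval F `<=` i.2] else [set F | sval F `&` i.2 !=set0].

Definition hyperspace : topologicalType :=
  subbase_space hyper_subbase_dom hyper_subbase.

Let T1X : T1_space X := regX.1.

Let closedK K : Kf K -> closed K.
Proof. by move=> /compactK; exact: regular_closed_compact. Qed.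

Lemma open_hyper_sub (U : set X) : open U -> ~ U b ->
  open [set F : hyperspace | sval F `<=` U].
Proof.
by move=> oU nUb; exact: (@open_subbase _ _ hyper_subbase_dom _ (true, U)).
Qed.

Lemma open_hyper_meet (U : set X) : open U ->
  open [set F : hyperspace | sval F `&` U !=set0].
Proof.
by move=> oU; exact: (@open_subbase _ _ hyper_subbase_dom _ (false, U)).
Qed.

Lemma hyper_eq (F G : hyperspace) : sval F = sval G -> F = G.
Proof.
suff eqh (F' G' : hyper) : sval F' = sval G' -> F' = G' by exact: eqh.
by case: F' G' => F' ? [G' ?] /= ?; exact: eq_exist.
Qed.

Lemma hyper_b (F : hyper) : sval F b -> sval F = [set b].
Proof. by case: F => F FP /=; case: FP => _ _ [[_ nb] /nb|]. Qed.

Lemma hyper_nb (F : hyper) : ~ sval F b -> sval F a.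
Proof. by case: F => F FP /=; case: FP => _ _ [[]//|->] /(_ erefl). Qed.

Lemma hyper_closed (F : hyper) : closed (sval F).
Proof. by case: F => F FP /=; case: FP. Qed.

Lemma hyper_compact (F : hyper) : compact (sval F).
Proof.
case: F => F FP /=; case: FP => cF [K [KK FK]] _.
exact: subclosed_compact cF (compactK KK) FK.
Qed.

Lemma hyper_T1 : T1_space hyperspace.
Proof.
move=> F G FG.
have [FsubG|] := pselect (sval F `<=` sval G); last first.
  move=> /nonsubset[x [Fx nGx]].
  exists [set H : hyperspace | sval H `&` ~` sval G !=set0]; split.
    by apply: open_hyper_meet; rewrite openC; exact: hyper_closed.
  by split; [exists x|case=> y []].
(* Here [F] is a proper part of [G], so it misses [b] and some [y] of [G]; avoiding both is an open
   condition. *)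
have [GsubF|/nonsubset[y [Gy nFy]]] := pselect (sval G `<=` sval F).
  by case: FG; apply: hyper_eq; rewrite eqEsubset.
have nFb : ~ sval F b.
  move=> Fb; apply: nFy; rewrite (hyper_b Fb).
  by move: Gy; rewrite (hyper_b (FsubG _ Fb)).
exists [set H : hyperspace | sval H `<=` ~` [set y] `&` ~` [set b]]; split.
  apply: open_hyper_sub; last by move=> [_]; apply.
  by apply: openI; rewrite openC; exact: T1_closed1.
split=> [x Fx|sG]; last by have [yy _] := sG y Gy; exact: yy.
by split=> /= xe; [apply: nFy|apply: nFb]; rewrite -xe.
Qed.

Lemma hyper_regular : regular_sp hyperspace.
Proof.
apply: subbase_regular; first exact: hyper_T1.
case=> [[] U] F [/= oU nUb] FU; rewrite /hyper_subbase /= in FU *.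
  have [V [oV FV clV]] :=
    compact_regular_nbhd regX (@hyper_compact F) oU FU.
  exists [set H : hyperspace | sval H `<=` V]; split=> //.
    by apply: open_hyper_sub => // /subset_closure/clV/nUb; apply.
  apply: closure_sub_disjoint => G /nonsubset[x [Gx nUx]].
  exists [set H : hyperspace | sval H `&` ~` closure V !=set0]; split.
  - by apply: open_hyper_meet; rewrite openC; exact: closed_closure.
  - by exists x; split=> // /clV.
  - rewrite -subset0 => H [HV [y [Hy]]]; apply; apply: subset_closure.
    exact: HV.
have [x [Fx Ux]] := FU.
have [V [oV [Vx clV]]] := regX.2 x U oU Ux.
(* If [U] misses [b], the closure must still exclude the collapsed point, and containment conditions
   cannot do so; [O] keeps the sets off a neighborhood of [b]. *)
have [O [oO FO clO]] : exists O : set hyperspace,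
    [/\ open O, O F & ~ U b -> exists W, [/\ open W, W b &
      forall G, O G -> sval G `&` W = set0]].
  have [Fb|nFb] := pselect (sval F b).
    exists setT; split=> //; first exact: openT.
    by case; move: Fx; rewrite (hyper_b Fb) => <-.
  have [O [oO FO clO]] : exists O, [/\ open O, sval F `<=` O &
      closure O `<=` ~` [set b]].
    apply: compact_regular_nbhd => //; first exact: (@hyper_compact F).
      by rewrite openC; exact: T1_closed1.
    by move=> y Fy /= yb; apply: nFb; rewrite -yb.
  exists [set H : hyperspace | sval H `<=` O]; split=> //.
    by apply: open_hyper_sub => // /subset_closure/clO; apply.
  move=> _; exists (~` closure O); split.
  - by rewrite openC; exact: closed_closure.
  - by move=> /clO; apply.
  - move=> G GO; rewrite -subset0 => y [/GO Oy]; apply.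
    exact: subset_closure.
exists ([set H : hyperspace | sval H `&` V !=set0] `&` O); split.
- by apply: openI => //; exact: open_hyper_meet.
- by split=> //; exists x.
apply: closure_sub_disjoint => G GU.
have GnU y : sval G y -> ~ U y by move=> Gy Uy; apply: GU; exists y.
have [Gb|nGb] := pselect (sval G b).
  have [W [oW Wb OW]] := clO (GnU _ Gb).
  exists [set H : hyperspace | sval H `&` W !=set0]; split.
  - exact: open_hyper_meet.
  - by exists b.
  - rewrite -subset0 => H [[_ /OW HW]]; rewrite /= HW.
    by case.
exists [set H : hyperspace | sval H `<=` ~` closure V `&` ~` [set b]]; split.
- apply: open_hyper_sub; last by move=> [_]; apply.
  by apply: openI; rewrite openC; [exact: closed_closure|exact: T1_closed1].
- move=> y Gy; split; first by move=> /clV; exact: GnU.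
  by move=> yb; apply: nGb; rewrite -yb.
- rewrite -subset0 => H [[[y [Hy Vy]] _] HV].
  by have [] := HV y Hy; case; exact: subset_closure.
Qed.

Let hyperpoint_b : hyperpoint [set b].
Proof.
split; [exact: T1_closed1| |by right].
by have [K [KK Kb]] := coverK b; exists K; split=> // x ->.
Qed.

Let hyperpoint_a : hyperpoint [set a].
Proof.
split; [exact: T1_closed1| |by left; split=> // ba; exact: ab].
by have [K [KK Kb]] := coverK a; exists K; split=> // x ->.
Qed.

Lemma hyper_nontrivial : exists F G : hyperspace, F <> G.
Proof.
exists (exist _ _ hyperpoint_a), (exist _ _ hyperpoint_b).
by move=> /(congr1 (fun F => sval F a)) /= E; apply: ab; rewrite -E.
Qed.

Hypothesis ab_inseparable :
  forall f : X -> Rdefinitions.R, continuous f -> f a = f b.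

(** If [F] misses [b], it contains [a], so the path [g] starts at [g a = F]. It ends at the
    collapsed point, and [f \o g] cannot tell [a] from [b]. *)
Lemma hyper_rigid : R_rigid hyperspace.
Proof.
move=> f cf.
suff fb F : f F = f (exist _ _ hyperpoint_b) by move=> F G; rewrite !fb.
have [Fb|nFb] := pselect (sval F b).
  by congr f; apply: hyper_eq; rewrite /= (hyper_b Fb).
have path x : exists G : hyperspace,
    (x = b -> sval G = [set b]) /\ (x <> b -> sval G = sval F `|` [set x]).
  have [->|xb] := pselect (x = b).
    by exists (exist _ _ hyperpoint_b).
  have hFx : hyperpoint (sval F `|` [set x]).
    split.
    - by apply: closedU; [exact: hyper_closed|exact: T1_closed1].
    - have [Kx [KKx Kxx]] := coverK x.
      have [_ [K [KK FK]] _] := svalP F.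
      have [|L [KL sL]] := directedK (F := fun n => if n is 0 then K else Kx).
        by case.
      exists L; split=> // y [/FK/(sL 0)//|->].
      exact: (sL 1).
    - by left; split; [left; exact: hyper_nb|case=> // /esym].
  by exists (exist _ _ hFx).
have [g gP] := choice path.
have gb : sval (g b) = [set b] by apply: (gP b).1.
have gx x : x <> b -> sval (g x) = sval F `|` [set x] by apply: (gP x).2.
have cg : continuous g.
  apply: continuous_subbase => -[[] U] [/= oU nUb]; apply: open_local => x.
    rewrite /hyper_subbase /= => gU.
    have xb : x <> b.
      by move=> xb; apply: nUb => //; apply: gU; rewrite xb gb.
    exists U; rewrite gx // in gU; split=> //; first by apply: gU; right.
    move=> y Uy /=; rewrite gx; last by move=> yb; apply: nUb; rewrite // -yb.
    by move=> z [Fz|->//]; apply: gU; left.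
  rewrite /hyper_subbase /= => -[z [gz Uz]].
  (* A point of [F] stays in [g y] for every [y] other than [b]. In the remaining case the point is
     [x] itself, and [y] lies in [g y] even for [y = b]. *)
  have [FU|nFU] := pselect (x <> b /\ sval F z).
    have [xb Fz] := FU; exists (~` [set b]); split=> //.
      by rewrite openC; exact: T1_closed1.
    by move=> y yb; exists z; split=> //; rewrite gx //; left.
  have zx : z = x.
    have [xb|xb] := pselect (x = b); first by move: gz; rewrite xb gb.
    by move: gz; rewrite gx // => -[Fz|//]; case: nFU.
  rewrite zx in Uz; exists U; split=> // y Uy; exists y; split=> //.
  by have [->|yb] := pselect (y = b); [rewrite gb|rewrite gx //; right].
have fg : f (g a) = f (g b).
  apply: (ab_inseparable (f := f \o g)) => x.
  exact: continuous_comp (cg x) (cf (g x)).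
have <- : g a = F.
  apply: hyper_eq; rewrite gx // setUidl // => x ->; exact: hyper_nb.
by rewrite fg; congr f; apply: hyper_eq; rewrite gb.
Qed.

(** The limit is the set [L] of points whose neighborhoods meet [p]-many [G n], or the collapsed
    point if [L] contains [b]. Otherwise [p]-many [G n] miss [b] and so contain [a], and a common
    compact bound for the [G n] contains [L]. *)
Lemma hyper_ultracompact (p : set_system nat) : UltraFilter p ->
  ultracompact p hyperspace.
Proof.
move=> up G; have pp : ProperFilter p := ultra_proper.
pose L := [set x | forall U, open U -> U x ->
  p [set n | sval (G n) `&` U !=set0]].
have [Lb|nLb] := pselect (L b).
  exists (exist _ _ hyperpoint_b); apply: subbase_ultralimit.
  move=> -[[] U] [/= oU nUb]; rewrite /hyper_subbase /= => Ub.
    by case: nUb => //; exact: Ub.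
  by case: Ub => _ [-> /(Lb U oU)].
have [U0 [oU0 U0b pU0]] : exists U, [/\ open U, U b &
    p [set n | sval (G n) `&` U = set0]].
  apply: contrapT => nU; apply: nLb => U oU Ub.
  have [//|nGU] := in_ultra_setVsetC [set n | sval (G n) `&` U !=set0] up.
  case: nU; exists U; split=> //; apply: filterS nGU => n /= GU.
  by apply: contrapT => /eqP/set0P.
have [K_ KP] := choice (fun n => let: And3 _ KG _ := svalP (G n) in KG).
have [K [KK sK]] := directedK (fun n => (KP n).1).
have GK n : sval (G n) `<=` K by move=> x Gx; apply: (sK n); apply: (KP n).2.
have LK : L `<=` K.
  move=> x Lx; apply: contrapT => nKx.
  have oK : open (~` K) by rewrite openC; exact: closedK.
  have [n [y [Gy nKy]]] := filter_ex (Lx _ oK nKx).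
  by apply: nKy; exact: GK Gy.
have cL : closed L.
  rewrite -openC; apply: open_local => x nLx.
  have [U [oU [Ux npU]]] : exists U, open U /\ U x /\
      ~ p [set n | sval (G n) `&` U !=set0].
    apply: contrapT => nU; apply: nLx => U oU Ux.
    by apply: contrapT => npU; apply: nU; exists U.
  by exists U; split=> // y Uy Ly; apply: npU; exact: Ly.
have La : L a.
  move=> U oU Ua; apply: filterS pU0 => n GU0; exists a; split=> //.
  apply: hyper_nb => Gb.
  by have : (sval (G n) `&` U0) b by []; rewrite GU0.
have LP : hyperpoint L by split; [|exists K|left].
exists (exist _ _ LP); apply: subbase_ultralimit.
move=> -[[] U] [/= oU nUb]; rewrite /hyper_subbase /=; last first.
  by move=> [x [Lx Ux]]; exact: Lx.
move=> LU; have [//|nGU] := in_ultra_setVsetC [set n | sval (G n) `<=` U] up.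
have Gn0 n : exists x, sval (G n) x.
  by have [Gb|/hyper_nb Ga] := pselect (sval (G n) b); [exists b|exists a].
(* Points chosen outside [U] whenever possible have a [p]-limit in [L], hence in [U]. *)
have Gx n : exists x, sval (G n) x /\ (~ sval (G n) `<=` U -> ~ U x).
  have [GU|nGnU] := pselect (sval (G n) `<=` U).
    by have [x Gx] := Gn0 n; exists x.
  by have [x [Gx nUx]] := nonsubset nGnU; exists x.
have [x xP] := choice Gx.
have [z [Kz xz]] := compact_ultralimit up (compactK KK) (fun n => GK n _ (xP n).1).
have Lz : L z.
  move=> V oV Vz; apply: filterS (xz V oV Vz) => n Vx.
  by exists (x n); split=> //; exact: (xP n).1.
have [n [/= nGnU Ux]] := filter_ex (filterI nGU (xz U oU (LU z Lz))).
by case: ((xP n).2 nGnU).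
Qed.

End hyperspace.

(** * A Boolean group of finite sets of codes and its decoding function *)

Section codes.
Variable P : Type.

(* [Code len c u] encodes a sequence of finite sets of codes, the [n]-th one
   being [c n j] for [j < len n], with a value [u n] for each of them. *)
Inductive code : Type :=
  | Leaf of nat
  | Code of (nat -> nat) & (nat -> nat -> code) & (nat -> P).

HB.instance Definition _ := gen_eqMixin code.
HB.instance Definition _ := gen_choiceMixin code.

Definition code_set (s : code) (n : nat) : set code :=
  if s is Code len c _ then [set c n j | j in [set j | (j < len n)%N]] else set0.

Definition code_val (v0 : P) (s : code) (n : nat) : P :=
  if s is Code _ _ u then u n else v0.

(** Constituents are structurally smaller. The case of equal codes shows that no code is its own
    constituent. *)
Lemma code_asym (s t : code) (m n : nat) : code_set t m s -> code_set s n t ->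
  False.
Proof.
elim: t s m n => [k|len c IHc u] s m n /=.
  by [].
move=> [j jm <-] ts.
by apply: (IHc m j (Code len c u) n m ts) => /=; exists j.
Qed.

(** Indicator functions turn symmetric difference into pointwise exclusive or. *)
Definition boolgroup := {x : code -> bool | finite_set [set s | x s]}.

HB.instance Definition _ := gen_eqMixin boolgroup.
HB.instance Definition _ := gen_choiceMixin boolgroup.

Lemma boolgroup_eq (x y : boolgroup) : sval x =1 sval y -> x = y.
Proof.
move=> xy; have {}xy : sval x = sval y by apply: funext.
by case: x y xy => x xP [y yP] /= xy; exact: eq_exist.
Qed.

Definition bool_add (x y : boolgroup) : boolgroup.
Proof.
exists (fun s => sval x s (+) sval y s).
apply: (@sub_finite_set _ _ ([set s | sval x s] `|` [set s | sval y s])).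
  by move=> s /=; case: (sval x s) => //= ?; [left|right].
by rewrite finite_setU; split; [exact: (svalP x)|exact: (svalP y)].
Defined.

Definition bool_zero : boolgroup.
Proof.
by exists (fun=> false); apply: (@sub_finite_set _ _ set0) => // s.
Defined.

Definition bool_gen (s : code) : boolgroup.
Proof.
exists (eq_op^~ s); apply: (@sub_finite_set _ _ [set s]) => // t /eqP //.
Defined.

Lemma bool_addA : associative bool_add.
Proof. by move=> x y z; apply: boolgroup_eq => s /=; rewrite addbA. Qed.

Lemma bool_addC : commutative bool_add.
Proof. by move=> x y; apply: boolgroup_eq => s /=; rewrite addbC. Qed.

Lemma bool_add_group : is_group bool_add bool_zero id.
Proof.
split; first exact: bool_addA.
split=> x; split; apply: boolgroup_eq => s /=; rewrite ?addbF ?addbb //.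
Qed.

Lemma bool_gen_inj : injective bool_gen.
Proof.
by move=> s t /(congr1 (fun x => sval x s)) /=; rewrite eqxx => /esym/eqP.
Qed.

Lemma boolgroup_infinite : infinite_set [set: boolgroup].
Proof.
move=> fin; apply: infinite_nat.
rewrite -(preimage_setT (fun n => bool_gen (Leaf n))).
by apply: finite_preimage fin => m n _ _ /bool_gen_inj[].
Qed.

Definition code_decodes (v0 : P) (h : boolgroup) (v : P) := exists s n,
  (forall t, sval h t = (t == s) (+) `[< code_set s n t >]) /\
  v = code_val v0 s n.

(* The function [f] sends [s + g_n] to [u n] for each code [s] of sequences
   [g] and [u]; the code [s] can be recovered from [s + g_n], since two distinct
   codes cannot be constituents of each other. *)
Lemma decoding (v0 : P) : exists f : boolgroup -> P,
  forall A : set boolgroup, countable A -> forall u : boolgroup -> P,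
  exists h, forall g, A g -> f (bool_add h g) = u g.
Proof.
(* Any decoded value is accepted, and [v0] if there is none; uniqueness is settled at the end. *)
have decode h : exists v, forall v', code_decodes v0 h v' -> code_decodes v0 h v.
  have [[v hv]|nv] := pselect (exists v, code_decodes v0 h v); first by exists v.
  by exists v0 => v' hv'; case: nv; exists v'.
have [f fP] := choice decode; exists f => A cA u.
have [g gP] : exists g : nat -> boolgroup, forall x, A x -> exists n, g n = x.
  have /countable_injP[i injA] := cA.
  have inv n : exists y, forall x, A x -> i x = n -> y = x.
    have [[y [Ay yn]]|ny] := pselect (exists x, A x /\ i x = n).
      by exists y => x Ax xn; apply: injA; rewrite ?inE // xn.
    by exists bool_zero => x Ax xn; case: ny; exists x.
  have [g gP] := choice inv.
  by exists g => x Ax; exists (i x); apply: gP.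
have [l lP] := choice (fun n => (finite_seqP _).1 (svalP (g n))).
pose s := Code (fun n => size (l n)) (fun n j => nth (Leaf 0) (l n) j)
  (fun n => u (g n)).
have sE n : code_set s n = [set t | sval (g n) t].
  rewrite lP predeqE => t; split=> /= [[j jl <-]|tl]; first exact: mem_nth.
  by exists (index t (l n)); rewrite /= ?index_mem // nth_index.
exists (bool_gen s) => x /gP[n <-].
have [|r [m [rE ->]]] := fP (bool_add (bool_gen s) (g n)) (u (g n)).
  exists s, n; split=> // t; rewrite sE /=; congr (_ (+) _).
  by apply/idP/asboolP.
have nss k : sval (g k) s = false.
  apply/negP => gs; have kss : code_set s k s by rewrite sE.
  exact: (code_asym kss kss).
have nrr k : ~ code_set r k r by move=> rr; exact: (code_asym rr rr).
have rs : r = s.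
  apply: contrapT => /eqP rs.
  have sr : code_set r m s.
    apply/asboolP; have := rE s; rewrite /= eqxx nss eq_sym (negbTE rs).
    by case: asboolP.
  have rs' : code_set s n r.
    rewrite sE /=; have := rE r; rewrite /= eqxx (negbTE rs) addFb => ->.
    by case: asboolP => // /nrr.
  exact: (code_asym sr rs').
(* The indices [m] and [n] may differ, but the sets [g m] and [g n] coincide, which suffices as [u]
   depends on the set only. *)
rewrite rs /=; congr u; apply: boolgroup_eq => t.
have := rE t; rewrite /= rs => /addbI ->; rewrite sE.
by apply/idP/asboolP.
Qed.

End codes.

Lemma continuous_dist (K : realType) (T : topologicalType) (f : T -> K) :
  continuous f -> forall x eps, 0 < eps ->
  exists U, [/\ open U, U x & forall y, U y -> `|f y - f x| < eps].
Proof.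
move=> cf x eps eps0.
have /cvgrPdist_lt /(_ _ eps0) := cf x; rewrite /= nbhsE => -[U [oU Ux] sU].
by exists U; split=> // y Uy; rewrite distrC; exact: sU.
Qed.

(** * The Korovin orbit *)

Section orbit.
Variables (Z : topologicalType) (f : boolgroup Z -> Z).
Hypothesis full : countably_full (fun h g : boolgroup Z => f (bool_add h g)).
Hypotheses (regZ : regular_sp Z) (ntZ : exists x y : Z, x <> y).

Local Notation H := (boolgroup Z).

(* The topology of [Z^H] on the orbit of [f] under translations. *)
Definition orbit_space : topologicalType :=
  subbase_space [set q : H * set Z | open q.2]
    (fun q => [set h | q.2 (f (bool_add h q.1))]).

Lemma open_orbit (g : H) (V : set Z) : open V ->
  open [set h : orbit_space | V (f (bool_add h g))].
Proof. by move=> oV; exact: (@open_subbase _ _ _ _ (g, V)). Qed.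

Lemma orbit_coord_nbhs (t : orbit_space) (U : set orbit_space) :
  open U -> U t -> coord_nbhs (fun h g : H => f (bool_add h g)) t U.
Proof. exact: subbase_nbhsP. Qed.

Lemma orbit_regular : regular_sp orbit_space.
Proof.
apply: subbase_regular.
  move=> h h' hh'; have [x [y xy]] := ntZ.
  (* By commutativity points and coordinates can be exchanged: fullness yields a coordinate [t]
     where [h] takes the value [x] and [h'] the value [y]. *)
  have c2 : countable [set h; h'] by apply: countableU; exact: countable1.
  have [t tP] := full c2 (fun k => if k == h then x else y).
  have [V [oV [Vx nVy]]] := regZ.1 x y xy.
  exists [set k : orbit_space | V (f (bool_add k t))]; split.
    exact: open_orbit.
  rewrite /= !(bool_addC _ t) !tP ?eqxx; [|by right|by left].
  by rewrite ifN //; apply/eqP => /esym.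
move=> [g V] h /= oV Vh; have [W [oW [Wh clW]]] := regZ.2 _ _ oV Vh.
exists [set k : orbit_space | W (f (bool_add k g))]; split=> //.
  exact: open_orbit.
apply: closure_sub_disjoint => y nVy.
exists [set k : orbit_space | (~` closure W) (f (bool_add k g))]; split.
- by apply: open_orbit; rewrite openC; exact: closed_closure.
- by move=> /clW.
- by rewrite -subset0 => z [/= Wz]; apply; exact: subset_closure.
Qed.

(** Translation by [k] only replaces the coordinate [g] by [k + g]. *)
Lemma orbit_translation (k : H) :
  continuous (fun x : orbit_space => bool_add k x : orbit_space).
Proof.
apply: continuous_subbase => -[g V] /= oV.
rewrite (_ : _ @^-1` _ =
  [set h : orbit_space | V (f (bool_add h (bool_add k g)))]).
  exact: open_orbit.
by rewrite predeqE => h /=; rewrite bool_addA (bool_addC h).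
Qed.

Lemma orbit_quasitopological_group :
  quasitopological_group (T := orbit_space) (@bool_add Z) (bool_zero Z) id.
Proof.
split; first exact: bool_add_group.
split; first exact: orbit_translation.
split; last by move=> x; exact: cvg_id.
move=> k; rewrite (_ : (fun x : orbit_space => _) = bool_add k).
  exact: orbit_translation.
by apply: funext => x; exact: bool_addC.
Qed.

Hypothesis ucZ : forall p, UltraFilter p -> ultracompact p Z.

Lemma orbit_feebly_compact : feebly_compact orbit_space.
Proof.
have [p [up free]] := free_ultrafilter.
apply: (coord_feebly_compact (T := orbit_space) up free (ucZ up) full).
exact: orbit_coord_nbhs.
Qed.

Lemma orbit_rigid : R_rigid Z -> R_rigid orbit_space.
Proof.
move=> rigZ phi cphi; have [p [up free]] := free_ultrafilter.
apply: (coord_continuous_rigid full up free (ucZ up) (K := Rdefinitions.R)) => //.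
move=> t eps eps0.
have [U [oU Ut Ue]] := continuous_dist (K := Rdefinitions.R) cphi t eps0.
have [l [lt lU]] := orbit_coord_nbhs oU Ut.
by exists l; split=> // t' /lU; exact: Ue.
Qed.

End orbit.

(** * The chain of planks and its inseparable end points *)

Lemma uncountable_cantor (A : set (nat -> bool)) : countable A ->
  exists s, ~ A s.
Proof.
move=> /countable_injP[i injA].
have [s sP] : exists s : nat -> bool,
    forall n, s n = `[< exists x, [/\ A x, i x = n & ~~ x n] >] by eexists.
exists s => As; have : s (i s) = ~~ s (i s).
  rewrite {1}sP; apply/asboolP/idP => [[x [Ax ix]]|nss]; last by exists s.
  by rewrite (injA x s) ?inE.
by case: (s (i s)).
Qed.

Lemma countable_preimage (T U : Type) (f : T -> U) (A : set U) :
  injective f -> countable A -> countable (f @^-1` A).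
Proof.
move=> injf /countable_injP[i injA]; apply/countable_injP.
exists (i \o f) => x y; rewrite !inE => Ax Ay xy; apply: injf.
by apply: injA; rewrite ?inE.
Qed.

Lemma ultracompact_bool (p : set_system nat) : UltraFilter p ->
  ultracompact p bool.
Proof.
move=> up u; have pp : ProperFilter p := ultra_proper.
exists `[< p [set n | u n] >] => U _; case: asboolP => [pu|npu] Ub.
  by apply: filterS pu => n /= un; rewrite un.
have [//|nu] := in_ultra_setVsetC [set n | u n] up.
by apply: filterS nu => n /negP; rewrite -eqbF_neg => /eqP /= ->.
Qed.

Lemma coord_nbhs_filter (T : Type) (I : eqType) (P : topologicalType)
  (e : T -> I -> P) (t : T) : Filter (coord_nbhs e t).
Proof.
split.
- by exists [::].
- move=> U V [l [lt lU]] [m [mt mV]]; exists (l ++ m); split=> [q|t' lmt].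
    by rewrite mem_cat => /orP[/lt|/mt].
  by split; [apply: lU|apply: mV] => q ql; apply: lmt; rewrite mem_cat ql ?orbT.
- by move=> U V UV [l [lt lU]]; exists l; split=> // t' /lU/UV.
Qed.

Section chain.
Local Notation S := (nat -> bool).

(** Each point records coordinates for all planks at once, so gluing becomes equality and no
    quotient is formed. *)
Definition chain_level (n : int) (w : (S -> bool) * (int -> S -> bool)) :=
  (forall i s, i < n -> w.2 i s = w.1 s) /\
  (forall i s, n < i -> w.2 i s = false).

Definition co_countable (x : S -> bool) :=
  exists A : set S, countable A /\ forall s, ~ A s -> x s.

(* Level [n] is the product of the space of the co-countable [x] and of the
   space of all [y = w.2 n]; the points with [y = x] of level [n] are the points
   with [y = 0] of level [n + 1]. *)
Definition chain_mid :=
  {w : (S -> bool) * (int -> S -> bool) |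
    co_countable w.1 /\ exists n, chain_level n w}.

Inductive chain := Top | Bot | Mid of chain_mid.

Definition mid_set (Q : (S -> bool) -> (int -> S -> bool) -> Prop) : set chain :=
  [set z | if z is Mid w then Q (sval w).1 (sval w).2 else False].

(** The neighborhoods of [Top] lie above the zero section of plank [n], those of [Bot] below its
    diagonal. *)
Definition chain_subbase (i : (S + int * S) * bool + int * bool) : set chain :=
  match i with
  | inl (inl s, c) => mid_set (fun x y => x s = c)
  | inl (inr (n, s), c) => mid_set (fun x y => y n s = c)
  | inr (n, true) => [set z | match z with
      Top => True | Bot => False | Mid w => exists s, (sval w).2 n s end]
  | inr (n, false) => [set z | match z with
      Top => False | Bot => True
      | Mid w => exists s, (sval w).2 n s <> (sval w).1 s end]
  end.

Definition chain_space : topologicalType := subbase_space setT chain_subbase.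

Let bitx s c : set chain_space := mid_set (fun x y => x s = c).
Let bity n s c : set chain_space := mid_set (fun x y => y n s = c).
Let upper n : set chain_space := chain_subbase (inr (n, true)).
Let lower n : set chain_space := chain_subbase (inr (n, false)).

Let open_bitx s c : open (bitx s c).
Proof. by have := @open_subbase _ _ setT chain_subbase (inl (inl s, c)); apply. Qed.

Let open_bity n s c : open (bity n s c).
Proof.
by have := @open_subbase _ _ setT chain_subbase (inl (inr (n, s), c)); apply.
Qed.

Let open_upper n : open (upper n).
Proof. exact: (@open_subbase _ _ setT). Qed.

Let open_lower n : open (lower n).
Proof. exact: (@open_subbase _ _ setT). Qed.

(** Hence the zero section and the diagonal of a plank are disjoint. *)
Lemma mid_nonzero (w : chain_mid) : exists s, (sval w).1 s.
Proof.
have [[A [cA Aw]] _] := svalP w.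
by have [s nAs] := uncountable_cantor cA; exists s; exact: Aw.
Qed.

(** A nonzero coordinate [n] forces the level to be at least [n]; dually, in [mid_neq], a coordinate
    other than [x] forces it to be at most [n]. *)
Lemma mid_true (w : chain_mid) m n s t :
  (sval w).2 n s -> m < n -> (sval w).2 m t = (sval w).1 t.
Proof.
have [_ [k [kl kr]]] := svalP w => ns mn; apply: kl.
have [/kr kn|] := ltrP k n; first by rewrite kn in ns.
exact: lt_le_trans.
Qed.

Lemma mid_neq (w : chain_mid) m n s t :
  (sval w).2 n s <> (sval w).1 s -> n < m -> (sval w).2 m t = false.
Proof.
have [_ [k [kl kr]]] := svalP w => ns nm; apply: kr.
have [/kl kn|] := ltrP n k; first by rewrite kn in ns.
by move=> kn; exact: le_lt_trans nm.
Qed.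

(* The points bounded away from [Top] and [Bot] form a zero-dimensional space. *)
Lemma chain_bit_regular (s : S) (c : bool) (n : int) (w : chain_mid) :
  ((sval w).1 s = c -> exists V : set chain_space,
     [/\ open V, V (Mid w) & closure V `<=` bitx s c]) /\
  ((sval w).2 n s = c -> exists V : set chain_space,
     [/\ open V, V (Mid w) & closure V `<=` bity n s c]).
Proof.
have [s1 xs1] := mid_nonzero w; have [_ [k [kl kr]]] := svalP w.
(* Three bits confine the level to the range from [k - 1] to [k + 1], away from both ends. *)
pose B := bitx s1 true `&` (bity (k + 1) s1 false `&` bity (k - 1) s1 true).
have oB : open B by do 2?apply: openI => //.
have wB : B (Mid w).
  by split=> //; split; [apply: kr; lia|rewrite /bity /= kl //; lia].
have BTop : B `&` upper (k + 2) = set0.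
  rewrite -subset0 => -[[[[] _] _]|[[[] _] _]|v [[x1 [y1 _]] [t]]].
  rewrite /= in x1 y1 *; rewrite (@mid_neq v _ (k + 1) s1) ?x1 ?y1 //; lia.
have BBot : B `&` lower (k - 2) = set0.
  rewrite -subset0 => -[[[[] _] _]|[[[] _] _]|v [[_ [_ y1]] [t]]].
  by apply; rewrite (@mid_true v _ (k - 1) s1) //; lia.
have clopen (E : bool -> set chain_space) :
    (forall c, open (E c)) -> (forall v, exists c, E c (Mid v)) ->
    E true `&` E false = set0 -> E c (Mid w) ->
    exists V : set chain_space,
      [/\ open V, V (Mid w) & closure V `<=` E c].
  move=> oE Ecover Edisj Ew; exists (E c `&` B); split=> //; first exact: openI.
  apply: closure_sub_disjoint => -[nE|nE|v nE].
  - exists (upper (k + 2)); split=> //.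
    by rewrite -setIA BTop setI0.
  - exists (lower (k - 2)); split=> //.
    by rewrite -setIA BBot setI0.
  - have [d Ed] := Ecover v; exists (E d); split=> //.
    rewrite setIAC [X in X `&` _](_ : _ = set0) ?set0I //.
    by case: c d Ew nE Ed => -[] _ nE Ed //; rewrite setIC.
split=> wc; [apply: (clopen (bitx s))|apply: (clopen (bity n s))] => //.
- by move=> v; exists ((sval v).1 s).
- by rewrite -subset0 => -[[[] _]|[[] _]|v [/= ->]].
- by move=> v; exists ((sval v).2 n s).
- by rewrite -subset0 => -[[[] _]|[[] _]|v [/= ->]].
Qed.

Lemma chain_T1 : T1_space chain_space.
Proof.
have sep (z z' : chain_space) (i : (S + int * S) * bool + int * bool) :
    chain_subbase i z -> ~ chain_subbase i z' ->
    exists U : set chain_space, open U /\ U z /\ ~ U z'.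
  by move=> iz iz'; exists (chain_subbase i); split=> //; exact: open_subbase.
have away (v : chain_mid) : exists n, ~ upper n (Mid v) /\
    exists m, ~ lower m (Mid v).
  have [_ [k [kl kr]]] := svalP v; exists (k + 1); split.
    by case=> [s]; rewrite kr //; lia.
  by exists (k - 1); case=> [s]; rewrite kl //; lia.
case=> [||w] [||v] zz' //.
- by apply: (sep _ _ (inr (0, true))) => //.
- by have [n [nv _]] := away v; apply: (sep _ _ (inr (n, true))) => //.
- by apply: (sep _ _ (inr (0, false))) => //.
- by have [_ [_ [n nv]]] := away v; apply: (sep _ _ (inr (n, false))) => //.
- by apply: (sep _ _ (inl (inl point, (sval w).1 point))).
- by apply: (sep _ _ (inl (inl point, (sval w).1 point))).
have [xx|xx] := pselect (forall s, (sval w).1 s = (sval v).1 s); last first.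
  have [s xs] : exists s, (sval w).1 s <> (sval v).1 s.
    apply: contrapT => nx; apply: xx => s; apply: contrapT => xs.
    by apply: nx; exists s.
  by apply: (sep _ _ (inl (inl s, (sval w).1 s))) => //= /esym.
have [n [s ys]] : exists n s, (sval w).2 n s <> (sval v).2 n s.
  apply: contrapT => ny; apply: zz'; congr Mid.
  case: w v xx ny => -[x y] wP [[x' y'] vP] /= xx ny; apply: eq_exist.
  congr pair; apply: funext => // n; apply: funext => s.
  by apply: contrapT => ys; apply: ny; exists n, s.
by apply: (sep _ _ (inl (inr (n, s), (sval w).2 n s))) => //= /esym.
Qed.

(** At the end points, the closure of [upper (n + 1)] lies in [upper n], and that of [lower (n - 1)]
    in [lower n]. Elsewhere [chain_bit_regular] applies. *)
Lemma chain_regular : regular_sp chain_space.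
Proof.
apply: subbase_regular chain_T1 _ => -[[[s|[n s]] c]|[n []]] z _.
- by case: z => // w wc; exact: (chain_bit_regular s c 0 w).1.
- by case: z => // w wc; exact: (chain_bit_regular s c n w).2.
- case: z => [_|[]|w [s ns]]; last first.
    have [V [oV Vw clV]] := (chain_bit_regular s true n w).2 ns.
    by exists V; split=> // -[/clV|/clV|v /clV] // vs; exists s.
  exists (upper (n + 1)); split=> //.
  apply: closure_sub_disjoint => -[[]|_|v nv] //.
    exists (lower n); split=> //.
    rewrite -subset0 => -[[_ []]|[[] _]|u [[s us] [t]]].
    by apply; rewrite (mid_true _ us) //; lia.
  have [s xs] := mid_nonzero v.
  exists (bitx s true `&` bity n s false); split; first exact: openI.
    split=> //; rewrite /bity /=; apply: contrapT => ys; apply: nv.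
    by exists s; case: ((sval v).2 n s) ys.
  rewrite -subset0 => -[[_ [[]]]|[[] _]|u [[t ut] [/= xu yu]]].
  by move: ut; rewrite (@mid_neq u _ n s) ?xu ?yu //; lia.
- case: z => [[]|_|w [s ns]]; last first.
    have [V [oV Vw clV]] := (chain_bit_regular s _ n w).2 erefl.
    have [W [oW Ww clW]] := (chain_bit_regular s _ n w).1 erefl.
    exists (V `&` W); split=> //; first exact: openI.
    move=> z clz.
    have /clV zV := closureS (@subIsetl _ V W) clz.
    have /clW zW := closureS (@subIsetr _ V W) clz.
    by case: z {clz} zV zW => // v /= yv xv; exists s; rewrite yv xv.
  exists (lower (n - 1)); split=> //.
  apply: closure_sub_disjoint => -[_|[]|v nv] //; last first.
    have [s xs] := mid_nonzero v.
    exists (bity n s true); split=> //.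
      rewrite /bity /=; apply: contrapT => ys; apply: nv.
      by exists s; rewrite xs.
    rewrite -subset0 => -[[[] _]|[_ []]|u [[t ut] /= us]].
    by apply: ut; rewrite (mid_true _ us) //; lia.
  exists (upper n); split=> //.
  rewrite -subset0 => -[[[] _]|[_ []]|u [[s us] [t]]].
  by rewrite (mid_neq _ us) //; lia.
Qed.

Definition chain_part (A : set S) : set chain_space :=
  [set z | if z is Mid w then forall s, ~ A s -> (sval w).1 s else True].

Let mid_level n : set chain_space :=
  [set z | if z is Mid w then chain_level n (sval w) else False].

(** An ultrafilter either converges to an end or lives on one level [j], where it converges bit by
    bit. The limit is co-countable because its bits outside [A] are fixed. *)
Lemma chain_part_compact (A : set S) : countable A -> compact (chain_part A).
Proof.
move=> cA.
rewrite compact_ultra => F uF FA; have pF : ProperFilter F := ultra_proper.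
have cvg_subbase (z : chain_space) :
    (forall i, chain_subbase i z -> F (chain_subbase i)) -> F --> z.
  move=> zF U; rewrite nbhsE => -[V [oV Vz] VU].
  have [l [lz lV]] := subbase_nbhsP oV Vz.
  have : F [set y | forall i, i \in l -> chain_subbase i y].
    by apply: filter_seq_forall => i /lz[_]; exact: zF.
  by apply: filterS => y /lV/VU.
have [upF|] := pselect (forall n, F (upper n)).
  exists Top; split=> //; apply: cvg_subbase => -[[[s|[n s]] c]|[n []]] //.
  by move=> _; exact: upF.
have [loF|] := pselect (forall n, F (lower n)).
  exists Bot; split=> //; apply: cvg_subbase => -[[[s|[n s]] c]|[n []]] //.
  by move=> _; exact: loF.
move=> /existsNP[m nloF] /existsNP[n nupF].
have {nloF}loF : F (~` lower m) by case: (in_ultra_setVsetC (lower m) uF).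
have {nupF}upF : F (~` upper n) by case: (in_ultra_setVsetC (upper n) uF).
(* Induction on the number of planks left. For [d = 0] the coordinate [m] would be both zero and
   [x]; in the step either plank [m + d] is the right one, or [upper (m + d)] is avoided too. *)
have mid_level_ex d : F (~` upper (m + d%:Z)) -> exists j, F (mid_level j).
  elim: d => [F0|d IHd Fd].
    have [z [zm]] := filter_ex (filterI loF F0); case: z zm => [||w] lm um.
    - by case: um.
    - by case: lm.
    - have [s xs] := mid_nonzero w; case: lm; exists s => ys; case: um.
      by exists s; rewrite addr0 ys.
  have [/IHd//|] := pselect (F (~` upper (m + d%:Z))).
  move=> nF; have {}nF : F (upper (m + d%:Z)).
    by case: (in_ultra_setVsetC (upper (m + d%:Z)) uF).
  exists (m + d%:Z); apply: filterS (filterI nF Fd) => -[[_ []]//|[]//|w].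
  move=> [[s us] nu] /=; split=> i t ij; first exact: mid_true us ij.
  have ydS r : (sval w).2 (m + d.+1%:Z) r = false.
    by apply: contrapT => yr; apply: nu; exists r; case: ((sval w).2 _ r) yr.
  have [->|inS] := eqVneq i (m + d.+1%:Z); first exact: ydS.
  have [r xr] := mid_nonzero w.
  by apply: (@mid_neq w _ (m + d.+1%:Z) r); [rewrite ydS xr|lia].
have [j Fj] : exists j, F (mid_level j).
  apply: (mid_level_ex `|n - m|%N); apply: filterS upF => -[[]//|_ []//|w].
  move=> nu [s us]; apply: nu.
  have [->|nneq] := eqVneq n (m + `|n - m|%N); first by exists s.
  have [r xr] := mid_nonzero w; exists r.
  by rewrite (mid_true _ us) //; lia.
pose x s := `[< F (bitx s true) >].
pose y n s := `[< F (bity n s true) >].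
have bitE (E : bool -> set chain_space) (c : bool) :
    (forall w, E true (Mid w) \/ E false (Mid w)) ->
    `[< F (E true) >] = c -> F (E c).
  move=> Ecover; case: asboolP => [FE <-//|nFE <-].
  have [//|FE] := in_ultra_setVsetC (E true) uF.
  apply: filterS (filterI FE Fj) => -[[_ []]|[_ []]|w [nE _]].
  by case: (Ecover w).
have bitxE s c : x s = c -> F (bitx s c).
  apply: bitE => w; rewrite /bitx /=; case: (_ s); by [left|right].
have bityE n' s c : y n' s = c -> F (bity n' s c).
  apply: bitE => w; rewrite /bity /=; case: (_ s); by [left|right].
have bit_ex (Q : set chain_space) : F Q -> exists w : chain_mid,
    [/\ Q (Mid w), chain_level j (sval w) & forall s, ~ A s -> (sval w).1 s].
  move=> FQ; have [z zP] := filter_ex (filterI (filterI FQ Fj) FA).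
  by case: z zP => [[[_ []]]|[[_ []]]|w [[Qw lw] Aw]]; exists w.
have xA s : ~ A s -> x s.
  move=> nAs; have [w [<- _ Aw]] := bit_ex _ (bitxE s _ erefl).
  exact: Aw.
have level_xy : chain_level j (x, y).
  split=> i s ij.
    have [w [[/= <- <-] lw _]] :=
      bit_ex _ (filterI (bityE i s _ erefl) (bitxE s _ erefl)).
    exact: lw.1.
  have [w [/= <- lw _]] := bit_ex _ (bityE i s _ erefl).
  exact: lw.2.
have midxy : co_countable x /\ exists n, chain_level n (x, y).
  by split; [exists A|exists j].
exists (Mid (exist _ (x, y) midxy)); split=> //; apply: cvg_subbase.
move=> [[[s|[i s]] c]|[i []]] /=; [exact: bitxE|exact: bityE| |].
- move=> [s ys]; apply: filterS (bityE i s _ ys) => -[[]|[]|w ws].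
  by exists s.
- move=> [s ys].
  apply: filterS (filterI (bityE i s _ erefl) (bitxE s _ erefl)).
  by move=> [[[]]|[[]]|w [/= yw xw]]; exists s; rewrite yw xw.
Qed.

Definition chain_parts : set (set chain_space) :=
  [set chain_part A | A in [set A | countable A]].

Lemma chain_parts_compact K : chain_parts K -> compact K.
Proof. by move=> [A cA <-]; exact: chain_part_compact. Qed.

Lemma chain_parts_directed (F : nat -> set chain_space) :
  (forall n, chain_parts (F n)) ->
  exists K, chain_parts K /\ forall n, F n `<=` K.
Proof.
move=> FP; have [A AP] := choice (fun n => let: ex_intro2 A cA AF := FP n in
  ex_intro (fun A => countable A /\ chain_part A = F n) A (conj cA AF)).
exists (chain_part (\bigcup_n A n)); split.
  exists (\bigcup_n A n) => //.
  by apply: bigcup_countable => // n _; exact: (AP n).1.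
move=> n; rewrite -(AP n).2 => -[//|//|w] /= wA s nAs; apply: wA => As.
by apply: nAs; exists n.
Qed.

Lemma chain_parts_cover (z : chain_space) : exists K, chain_parts K /\ K z.
Proof.
case: z => [||w]; last first.
  have [[A [cA Aw]] _] := svalP w.
  by exists (chain_part A); split=> //; exists A.
all: by exists (chain_part set0); split=> //; exists set0 => //; exact: countable0.
Qed.

Definition co_countable_fun := {x : S -> bool | co_countable x}.

Let level_fun (n : int) (t : co_countable_fun * (S -> bool)) (i : int) : S -> bool :=
  if i < n then sval t.1 else if i == n then t.2 else fun=> false.

Let level_mid_subproof (n : int) (t : co_countable_fun * (S -> bool)) :
  co_countable (sval t.1) /\ exists m, chain_level m (sval t.1, level_fun n t).
Proof.
split; first exact: svalP; exists n; split=> i s /=; rewrite /level_fun.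
  by move=> ->.
by move=> ni; rewrite ltNge (ltW ni) /= gt_eqF.
Qed.

Definition level_mid n t : chain_space :=
  Mid (exist _ (_, _) (level_mid_subproof n t)).

Let level_coord (t : co_countable_fun * (S -> bool)) (i : S + S) : bool :=
  match i with inl s => sval t.1 s | inr s => t.2 s end.

Let level_coord_full : countably_full level_coord.
Proof.
move=> A cA u.
(* The value [true] outside [A] keeps the element co-countable. *)
have cox : co_countable (fun s => `[< A (inl s) >] ==> u (inl s)).
  exists (inl @^-1` A); split; last by move=> s /= /asboolPn/negbTE ->.
  by apply: countable_preimage => // s t [].
exists (exist _ _ cox, fun s => u (inr s)) => -[s|s] //= As.
by rewrite asboolT.
Qed.

Let level_mid_continuous (f : chain_space -> Rdefinitions.R) (n : int) :
  continuous f -> coord_continuous level_coord (f \o level_mid n).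
Proof.
move=> cf t eps eps0.
have [U [oU Ut Ue]] := continuous_dist (K := Rdefinitions.R) cf (level_mid n t) eps0.
have [l [lt lU]] := subbase_nbhsP oU Ut.
have tF := coord_nbhs_filter level_coord t.
suff tl i : chain_subbase i (level_mid n t) ->
    coord_nbhs level_coord t (level_mid n @^-1` chain_subbase i).
  have : coord_nbhs level_coord t
      [set t' | forall i, i \in l -> chain_subbase i (level_mid n t')].
    by apply: filter_seq_forall => i /lt[_]; exact: tl.
  by apply: filterS => t' /lU; exact: Ue.
have coord_bit j : coord_nbhs level_coord t
    [set t' | level_coord t' j = level_coord t j].
  exists [:: (j, [set level_coord t j])]; split=> [q|t' /(_ _ (mem_head _ _)) //].
  by rewrite inE => /eqP -> /=; split=> //; exact: discrete_open.
have coord_y m s : coord_nbhs level_coord t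
    [set t' | level_fun n t' m s = level_fun n t m s].
  rewrite /level_fun; case: ifP => _; first exact: (coord_bit (inl s)).
  case: ifP => _; first exact: (coord_bit (inr s)).
  by apply: filterS filterT.
case: i => [[[s|[m s]] c]|[m []]] /=.
- by move=> <-; exact: (coord_bit (inl s)).
- by move=> <-; exact: coord_y.
- by move=> [s ys]; apply: filterS (coord_y m s) => t' /= ts; exists s; rewrite ts.
- move=> [s ys]; apply: filterS (filterI (coord_y m s) (coord_bit (inl s))).
  by move=> t' /= [ts xs]; exists s; rewrite ts xs.
Qed.

(** All planks together use a countable set [B] of coordinates. Take [x] to vanish exactly at the
    indices in [B]: then [f] agrees at [(x, 0)] and [(x, x)] on every plank, so it is constant along
    the points [z n], which tend to both ends. *)
Lemma chain_inseparable (f : chain_space -> Rdefinitions.R) :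
  continuous f -> f Top = f Bot.
Proof.
move=> cf; have [p [up free]] := free_ultrafilter.
have [A AP] := choice (fun n => coord_continuous_countable level_coord_full
  up free (ultracompact_bool up) (level_mid_continuous n cf)).
pose B := \bigcup_n A n.
have cB : countable B.
  by apply: bigcup_countable => [|n _]; [exact: countableP|exact: (AP n).1].
have cox : co_countable (fun s => ~~ `[< B (inl s) \/ B (inr s) >]).
  exists (inl @^-1` B `|` inr @^-1` B); split; last first.
    by move=> s nB; apply/asboolPn.
  by apply: countableU; apply: countable_preimage => // s t [].
pose x : co_countable_fun := exist _ _ cox.
pose z n := level_mid n (x, fun=> false).
have fz n : f (z n) = f (z (n + 1)).
  (* This is the gluing of the diagonal to the next zero section. *)
  have -> : z (n + 1) = level_mid n (x, sval x).
    congr Mid; apply: eq_exist; congr pair; apply: funext => i.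
    apply: funext => s; rewrite /level_fun /=.
    by case: (ltrgtP i (n + 1)) => i1; case: (ltrgtP i n) => //; lia.
  apply: (AP n).2 => -[//|s] As /=; apply/esym/negbTE; rewrite negbK.
  by apply/asboolP; right; exists n.
have fz0 n : f (z n) = f (z 0).
  have fzn (k : nat) : f (z k%:Z) = f (z 0).
    by elim: k => // k <-; rewrite (fz k%:Z); congr (f (z _)); lia.
  have fzN (k : nat) : f (z (- k%:Z)) = f (z 0).
    elim: k => // k <-; rewrite (fz (- k.+1%:Z)); congr (f (z _)); lia.
  case: (leP 0 n) => n0.
    by rewrite (_ : n = `|n|%N); [exact: fzn|lia].
  by rewrite (_ : n = - `|n|%N%:Z); [exact: fzN|lia].
have [s xs] : exists s, sval x s.
  have [A' [cA' A'x]] := cox; have [s nA's] := uncountable_cantor cA'.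
  by exists s; exact: A'x.
have limit (e : chain_space) (g : nat -> int) : (forall i,
    chain_subbase i e -> \forall k \near \oo, chain_subbase i (z (g k))) ->
    f e = f (z 0).
  move=> ge; apply/eqP; rewrite -subr_eq0 -normr_le0 leNgt; apply/negP => d0.
  have [U [oU Ue Uf]] := continuous_dist (K := Rdefinitions.R) cf e d0.
  have [l [le lU]] := subbase_nbhsP oU Ue.
  have : \forall k \near \oo, forall i, i \in l -> chain_subbase i (z (g k)).
    by apply: filter_seq_forall => i /le[_]; exact: ge.
  move=> /filter_ex[k /lU/Uf]; rewrite fz0 distrC ltxx //.
transitivity (f (z 0)).
  apply: (limit Top Posz) => -[[[s'|[m s']] c]|[m []]] //= _.
  (* Strictness is needed: [z k] has coordinate [k] zero, so it lies in [upper m] only for [m < k].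
     For [Bot] below, [- k <= m] is enough. *)
  exists `|m|.+1%N => // k /= mk.
  by exists s; rewrite /level_fun ifT //; lia.
apply/esym/(limit Bot (fun k => - k%:Z)) => -[[[s'|[m s']] c]|[m []]] //= _.
exists `|m|%N => // k /= mk; exists s; rewrite /level_fun.
have -> : (m < - k%:Z) = false by lia.
by rewrite if_same => /esym; move: xs => /= ->.
Qed.

End chain.

Theorem theorem5p1 :
  exists (H : topologicalType) (mul : H -> H -> H) (e : H) (inv : H -> H),
    quasitopological_group mul e inv /\
    infinite_set [set: H] /\
    regular_sp H /\
    feebly_compact H /\
    R_rigid H /\
    ~ completely_regular H /\
    ~ functionally_Hausdorff H.
Proof.
have TB : (Top : chain_space) <> Bot by [].
pose Z := @hyperspace chain_space Top Bot chain_parts.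
have regZ : regular_sp Z.
  exact: hyper_regular chain_regular chain_parts_compact.
have ntZ : exists F G : Z, F <> G.
  exact: hyper_nontrivial chain_regular TB chain_parts_cover.
have rigZ : R_rigid Z.
  apply: hyper_rigid chain_regular TB chain_parts_directed chain_parts_cover _.
  exact: chain_inseparable.
have ucZ p : UltraFilter p -> ultracompact p Z.
  exact: hyper_ultracompact chain_regular chain_parts_compact
    chain_parts_directed chain_parts_cover p.
have [z0 [z1 z01]] := ntZ.
have [f full] := decoding z0.
have rigH : R_rigid (orbit_space f) := orbit_rigid full ucZ rigZ.
have regH : regular_sp (orbit_space f) := orbit_regular full regZ ntZ.
have infH := @boolgroup_infinite Z.
have [x [y xy]] : exists x y : orbit_space f, x <> y.
  by exists (bool_gen (Leaf _ 0)), (bool_gen (Leaf _ 1)) => /bool_gen_inj.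
exists (orbit_space f), (@bool_add Z), (bool_zero Z), id.
split; first exact: orbit_quasitopological_group.
do 4?split=> //; first exact: (orbit_feebly_compact full ucZ).
split.
  move=> [_ cr]; have [g [cg [gx gy]]] := cr [set y] x
    (T1_closed1 (proj1 regH)) xy.
  have := rigH g cg x y; rewrite gx gy // => /eqP.
  by rewrite oner_eq0.
by move=> fH; have [g [cg]] := fH x y xy; apply; exact: rigH.
Qed.
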